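(* If $(\Omega,b,d)$ is a cyclic complex of $\mathbb{Q}$-vector spaces, then for all $n\ge 0$ there are (noncanonical) isomorphisms of vector spaces $$\mathsf{H}_n(\Omega,b,d)\cong \mathsf{H}_n(\Omega,b,B)\oplus\bigoplus_{i\ge 0}\ker\xi_{n-1-2i}\cap\mathrm{im}\,\xi_{n-1-2i},$$ where $\xi=bd+db$ and $B$ is the Connes coboundary map.
   Context: A mixed complex $(\Omega,b,d)$ of $\mathbb{Q}$-vector spaces consists of $\mathbb{Q}$-vector spaces $\Omega_n$ ($n\ge 0$; $\Omega_n=0$ for $n<0$) and linear maps $b_n:\Omega_n\to\Omega_{n-1}$, $d_n:\Omega_n\to\Omega_{n+1}$ with $b^2=0$, $d^2=0$ (so $b_0=0$, $d_{-1}=0$). Put $\xi_n=b_{n+1}d_n+d_{n-1}b_n:\Omega_n\to\Omega_n$. The Connes coboundary map is $B_n:=d_n\sum_{i=0}^n(\mathrm{id}-\xi_n)^i:\Omega_n\to\Omega_{n+1}$. The triple $(\Omega,b,B)$ is again a mixed complex. $(\Omega,b,d)$ is called a cyclic complex if $bB+Bb=0$. Mixed homology: for any mixed complex $(\Omega,b,d)$, $\mathsf{H}(\Omega,b,d)$ is the homology of the chain complex $(\mathsf{T}(\Omega),b+d)$, where $\mathsf{T}_n(\Omega):=\bigoplus_{i\ge 0}\hat\Omega_{n-2i}$ and $\hat\Omega_j:=\Omega_j/\mathrm{im}\,\xi_j$; the differential $\mathsf{T}_n(\Omega)\to\mathsf{T}_{n-1}(\Omega)$ sends $(x_n,x_{n-2},\dots)$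 to $(bx_n+dx_{n-2},\,bx_{n-2}+dx_{n-4},\dots)$ (so $dx_n$ is dropped). $\mathsf{H}$ is always formed using the operator $\xi$ of the mixed complex it is applied to; for $(\Omega,b,B)$ this is $bB+Bb$ (which is $0$ for a cyclic complex). *)

(* Defs.v *)
From HB Require Import structures.
From mathcomp Require Import all_boot all_order all_algebra.
From mathcomp Require Import boolp.

Set Implicit Arguments.
Unset Strict Implicit.
Unset Printing Implicit Defensive.

Import GRing.Theory.
Local Open Scope ring_scope.
Local Open Scope quotient_scope.

Section Subspaces.
Variables (R : pzRingType) (V : lmodType R) (S : submodClosed V).

Record subspace := Subspace {
  subspace_val : V;
  subspace_valP : subspace_val \in S }.

HB.instance Definition _ := [isSub for subspace_val].
HB.instance Definition _ := [Choice of subspace by <:].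
HB.instance Definition _ := [SubChoice_isSubLmodule of subspace by <:].

End Subspaces.

(* [submodClosed] does not inherit from [zmodClosed], which the library's
   quotient of a zmodType expects; [zmod_part S] is S seen as a subgroup. *)
Section Quotients.
Variables (R : pzRingType) (V : lmodType R) (S : submodClosed V).

Definition zmod_part : {pred V} := fun x => x \in S.

Fact zmod_part_closed : zmod_closed zmod_part.
Proof.
split=> [|x y xS yS]; rewrite unfold_in ?rpred0 //.
by rewrite rpredD // -scaleN1r rpredZ.
Qed.
HB.instance Definition _ := GRing.isZmodClosed.Build V zmod_part zmod_part_closed.

Definition quotient := Quotient.quot zmod_part.
HB.instance Definition _ := GRing.Zmodule.on quotient.
HB.instance Definition _ := EqQuotient.on quotient.

Lemma quot_piE (x y : V) : \pi_quotient x = \pi_quotient y <-> x - y \in S.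
Proof.
split=> [e|e].
  by have := Quotient.idealrBE zmod_part x y; rewrite e eqxx unfold_in.
by apply/eqP; rewrite -Quotient.idealrBE unfold_in.
Qed.

Lemma quot_surj (x : quotient) : exists y : V, x = \pi_quotient y.
Proof. by exists (repr x); rewrite reprK. Qed.

Definition quot_scale (a : R) (x : quotient) : quotient :=
  \pi_quotient (a *: repr x).

Lemma quot_piD (x y : V) :
  \pi_quotient (x + y) = \pi_quotient x + \pi_quotient y.
Proof. exact: Quotient.pi_add. Qed.

Lemma quot_pi0 : \pi_quotient (0 : V) = 0.
Proof. by apply: (addrI (\pi_quotient 0)); rewrite -quot_piD !addr0. Qed.

Lemma quot_piZ a (x : V) : \pi_quotient (a *: x) = quot_scale a (\pi_quotient x).
Proof.
by apply/quot_piE; rewrite -scalerBr rpredZ //; apply/quot_piE; rewrite reprK.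
Qed.

Fact quot_scaleA a b v : quot_scale a (quot_scale b v) = quot_scale (a * b) v.
Proof. by rewrite -[v]reprK -(quot_piZ b) -!quot_piZ scalerA. Qed.
Fact quot_scale1 : left_id 1 quot_scale.
Proof. by move=> v; rewrite -[v]reprK -quot_piZ scale1r. Qed.
Fact quot_scaleDr : right_distributive quot_scale +%R.
Proof.
by move=> a u v; rewrite -[u]reprK -[v]reprK -quot_piD -!quot_piZ scalerDr quot_piD.
Qed.
Fact quot_scaleDl v : {morph quot_scale^~ v : a b / a + b}.
Proof. by move=> a b; rewrite -[v]reprK -!quot_piZ scalerDl quot_piD. Qed.

HB.instance Definition _ := GRing.Zmodule_isLmodule.Build R quotient
  quot_scaleA quot_scale1 quot_scaleDr quot_scaleDl.

End Quotients.

Section QuotientMap.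
Variables (R : pzRingType) (V W : lmodType R).
Variables (S : submodClosed V) (T : submodClosed W) (f : {linear V -> W}).
Hypothesis fST : forall x, x \in S -> f x \in T.

(* [fST] is kept as an argument so that the linear instance can be inferred. *)
#[using="fST"]
Definition quot_map (x : quotient S) : quotient T := \pi_(quotient T) (f (repr x)).

Lemma quot_mapE (x : V) : quot_map (\pi_(quotient S) x) = \pi_(quotient T) (f x).
Proof. by apply/quot_piE; rewrite -raddfB fST //; apply/quot_piE; rewrite reprK. Qed.

Fact quot_map_linear : linear quot_map.
Proof.
move=> a x y; rewrite -[x]reprK -[y]reprK.
by rewrite -[a *: _](quot_piZ S a) -quot_piD !quot_mapE linearP quot_piD quot_piZ.
Qed.
HB.instance Definition _ := GRing.isLinear.Build R (quotient S) (quotient T)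
  _ quot_map quot_map_linear.
End QuotientMap.
Arguments quot_map {R V W S T f} fST.

Section KernelImage.
Variables (R : pzRingType) (V W : lmodType R) (f : {linear V -> W}).

Definition lin_kernel : {pred V} := fun x => f x == 0.
Definition lin_image : {pred W} := fun y => `[< exists x, f x = y >].

Fact lin_kernel_closed : submod_closed lin_kernel.
Proof.
split=> [|a x y /eqP fx /eqP fy]; rewrite unfold_in ?linear0 //.
by rewrite linearP fx fy scaler0 addr0.
Qed.
HB.instance Definition _ := GRing.isSubmodClosed.Build R V lin_kernel lin_kernel_closed.

Fact lin_image_closed : submod_closed lin_image.
Proof.
split=> [|a _ _ /asboolP[x <-] /asboolP[y <-]]; apply/asboolP.
  by exists 0; rewrite linear0.
by exists (a *: x + y); rewrite linearP.
Qed.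
HB.instance Definition _ := GRing.isSubmodClosed.Build R W lin_image lin_image_closed.

End KernelImage.

Section KernelCapImage.
Variables (R : pzRingType) (V : lmodType R) (f : {linear V -> V}).

Definition kernel_cap_image : {pred V} :=
  fun x => (x \in lin_kernel f) && (x \in lin_image f).

Fact kernel_cap_image_closed : submod_closed kernel_cap_image.
Proof.
split=> [|a x y /andP[xk xi] /andP[yk yi]]; apply/andP; split;
  by rewrite ?rpred0 // rpredD // rpredZ.
Qed.
HB.instance Definition _ :=
  GRing.isSubmodClosed.Build R V kernel_cap_image kernel_cap_image_closed.

End KernelCapImage.

Definition lmod_iso (R : pzRingType) (V W : lmodType R) : Prop :=
  exists f : {linear V -> W}, bijective f.

(* Nonnegatively graded chain complexes: [cdiff n] goes from degree n+1 to
   degree n, and the differential leaving degree 0 is zero. *)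
Record chain_complex := ChainComplex {
  cobj :> nat -> lmodType rat;
  cdiff : forall n, {linear cobj n.+1 -> cobj n};
  cdiffK : forall n x, cdiff n (cdiff n.+1 x) = 0 }.

Section Homology.
Variables (C : chain_complex) (n : nat).

Definition cycle : {pred C n} :=
  match n return {pred C n} with
  | 0 => fun _ => true
  | m.+1 => lin_kernel (cdiff C m)
  end.

Fact cycle_closed : submod_closed cycle.
Proof. by rewrite /cycle; case: n => [|m]; [split | exact: lin_kernel_closed]. Qed.
HB.instance Definition _ := GRing.isSubmodClosed.Build rat (C n) cycle cycle_closed.

Definition boundary : {pred subspace cycle} :=
  fun z => val z \in lin_image (cdiff C n).

Fact boundary_closed : submod_closed boundary.
Proof.
split=> [|a x y xb yb]; rewrite unfold_in ?raddf0 ?rpred0 //.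
by rewrite linearP rpredD // rpredZ.
Qed.
HB.instance Definition _ :=
  GRing.isSubmodClosed.Build rat (subspace cycle) boundary boundary_closed.

Definition homology : lmodType rat := quotient boundary.

End Homology.

(* Degrees n < 0 being zero, b starts in degree 1: [mb n] is b_{n+1} and
   [md n] is d_n. *)
Record mixed_complex := MixedComplex {
  mobj :> nat -> lmodType rat;
  mb : forall n, {linear mobj n.+1 -> mobj n};
  md : forall n, {linear mobj n -> mobj n.+1};
  mbK : forall n x, mb n (mb n.+1 x) = 0;
  mdK : forall n x, md n.+1 (md n x) = 0 }.

Definition xi (M : mixed_complex) (n : nat) : {linear M n -> M n} :=
  match n return {linear M n -> M n} with
  | 0 => mb M 0 \o md M 0
  | m.+1 => (mb M m.+1 \o md M m.+1) \+ (md M m \o mb M m)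
  end.

Lemma xi_md (M : mixed_complex) n x : xi M n.+1 (md M n x) = md M n (xi M n x).
Proof.
case: n x => [|n] x /=; first by rewrite mdK linear0 add0r.
by rewrite mdK linear0 add0r linearD mdK addr0.
Qed.

Lemma xi_mb (M : mixed_complex) n x : xi M n (mb M n x) = mb M n (xi M n.+1 x).
Proof.
case: n x => [|n] x /=; first by rewrite linearD /= mbK add0r.
by rewrite mbK linear0 addr0 linearD mbK add0r.
Qed.

Arguments xi : simpl never.

Section Connes.
Variable M : mixed_complex.

Definition connes_sum n (x : M n) : M n :=
  \sum_(i < n.+1) iter i (fun y => y - xi M n y) x.

Definition connes n (x : M n) : M n.+1 := md M n (connes_sum x).

Fact connes_linear n : linear (@connes n).
Proof.
move=> a x y; rewrite /connes -linearP; congr (md M n _).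
rewrite scaler_sumr -big_split /=; apply: eq_bigr => i _.
elim: (i : nat) => //= k ->; rewrite linearP.
by rewrite scalerBr opprD addrACA.
Qed.
HB.instance Definition _ n :=
  GRing.isLinear.Build rat (M n) (M n.+1) _ (@connes n) (@connes_linear n).

Fact connesK n (x : M n) : connes (connes x) = 0.
Proof.
rewrite /connes /connes_sum; set y := \sum_(i < n.+1) _.
rewrite raddf_sum big1 // => i _.
have [z ->]: exists z, iter i (fun u => u - xi M n.+1 u) (md M n y) = md M n z.
  elim: (i : nat) => [|k [z e]]; first by exists y.
  by exists (z - xi M n z); rewrite iterS e xi_md linearB.
exact: mdK.
Qed.

Definition connes_complex : mixed_complex :=
  @MixedComplex M (mb M) (fun n => @connes n) (@mbK M) connesK.

End Connes.

(* [xi (connes_complex M)] is bB + Bb. *)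
Definition cyclic_complex (M : mixed_complex) : Prop :=
  forall n (x : M n), xi (connes_complex M) n x = 0.

(* F_n (+) F_(n-2) (+) F_(n-4) (+) ... down to F_0 or F_1. *)
Fixpoint step2_sum (F : nat -> lmodType rat) (n : nat) : lmodType rat :=
  match n with
  | 0 => F 0
  | 1 => F 1
  | m.+2 => (F m.+2 * step2_sum F m)%type
  end.

Definition step2_head (F : nat -> lmodType rat) n : step2_sum F n -> F n :=
  match n return step2_sum F n -> F n with
  | 0 | 1 => id
  | m.+2 => fst
  end.

Fact step2_head_linear (F : nat -> lmodType rat) n : linear (@step2_head F n).
Proof. by case: n => [|[|n]]. Qed.
HB.instance Definition _ F n :=
  GRing.isLinear.Build rat (step2_sum F n) (F n) _ (@step2_head F n)
    (@step2_head_linear F n).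

Arguments step2_head : simpl never.

Section MixedHomology.
Variable M : mixed_complex.

Definition hatM (n : nat) : lmodType rat := quotient (lin_image (xi M n)).

Fact mb_im n x : x \in lin_image (xi M n.+1) -> mb M n x \in lin_image (xi M n).
Proof. by case/asboolP=> y <-; apply/asboolP; exists (mb M n y); rewrite xi_mb. Qed.
Fact md_im n x : x \in lin_image (xi M n) -> md M n x \in lin_image (xi M n.+1).
Proof. by case/asboolP=> y <-; apply/asboolP; exists (md M n y); rewrite xi_md. Qed.

Definition hat_mb n : {linear hatM n.+1 -> hatM n} :=
  quot_map (@mb_im n).
Definition hat_md n : {linear hatM n -> hatM n.+1} :=
  quot_map (@md_im n).

Arguments hat_mb : simpl never.
Arguments hat_md : simpl never.

Definition totM (n : nat) : lmodType rat := step2_sum hatM n.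

(* (x_(n+1), x_(n-1), ...) |-> (b x_(n+1) + d x_(n-1), b x_(n-1) + ...);
   the entry x_0, when present, has no b-component. *)
Fixpoint tot_diff (n : nat) : totM n.+1 -> totM n :=
  match n return totM n.+1 -> totM n with
  | 0 => fun x => hat_mb 0 x
  | 1 => fun x => hat_mb 1 x.1 + hat_md 0 x.2
  | m.+2 => fun x =>
      let y : totM m.+1 := x.2 in
      (hat_mb m.+2 x.1 + hat_md m.+1 (step2_head y), tot_diff y)
  end.

Fact tot_linear n : linear (@tot_diff n).
Proof.
elim/ltn_ind: n => -[|[|n]] IH a x y /=.
- exact: linearP.
- by rewrite !linearP /= scalerDr addrACA.
- congr pair; last exact: IH.
  by rewrite !linearP /= scalerDr addrACA.
Qed.
HB.instance Definition _ n :=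
  GRing.isLinear.Build rat (totM n.+1) (totM n) _ (@tot_diff n) (@tot_linear n).

Lemma hat_mbE n (x : M n.+1) :
  hat_mb n (\pi_(hatM n.+1) x) = \pi_(hatM n) (mb M n x).
Proof. exact: quot_mapE. Qed.
Lemma hat_mdE n (x : M n) :
  hat_md n (\pi_(hatM n) x) = \pi_(hatM n.+1) (md M n x).
Proof. exact: quot_mapE. Qed.

Lemma hat_mbK n x : hat_mb n (hat_mb n.+1 x) = 0.
Proof.
by have [y ->] := quot_surj x; rewrite (hat_mbE y) hat_mbE mbK quot_pi0.
Qed.
Lemma hat_mdK n x : hat_md n.+1 (hat_md n x) = 0.
Proof.
by have [y ->] := quot_surj x; rewrite (hat_mdE y) hat_mdE mdK quot_pi0.
Qed.
Lemma hat_mbd0 x : hat_mb 0 (hat_md 0 x) = 0.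
Proof.
have [y ->] := quot_surj x; rewrite (hat_mdE y) hat_mbE -quot_pi0.
apply/quot_piE; rewrite subr0.
by apply/asboolP; exists y.
Qed.
Lemma hat_mbd n x : hat_mb n.+1 (hat_md n.+1 x) + hat_md n (hat_mb n x) = 0.
Proof.
have [y ->] := quot_surj x.
rewrite (hat_mdE y) (hat_mbE y) hat_mbE hat_mdE.
rewrite -quot_piD -quot_pi0; apply/quot_piE; rewrite subr0.
by apply/asboolP; exists y.
Qed.

Fact totK n (x : totM n.+2) : tot_diff (tot_diff x) = 0.
Proof.
elim/ltn_ind: n x => -[|[|[|n]]] IH x /=.
- by rewrite linearD hat_mbK hat_mbd0 addr0.
- by rewrite !linearD /= hat_mbK add0r hat_mbd.
- congr pair; last exact: (IH 0%N isT x.2).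
  by rewrite !linearD /= hat_mbK hat_mdK add0r addr0 hat_mbd.
- congr pair; last exact: (IH n.+1 _ x.2).
  by rewrite !linearD /= hat_mbK hat_mdK add0r addr0 hat_mbd.
Qed.

Definition tot_complex : chain_complex :=
  @ChainComplex totM (fun n => @tot_diff n) totK.

Definition mixed_homology (n : nat) : lmodType rat := homology tot_complex n.

End MixedHomology.

(* The sum over i >= 0 of ker xi_(n-1-2i) /\ im xi_(n-1-2i), zero for n = 0. *)
Definition kernel_image_sum (M : mixed_complex) (n : nat) : lmodType rat :=
  match n with
  | 0 => 'rV[rat]_0
  | m.+1 => step2_sum (fun k => subspace (kernel_cap_image (xi M k))) m
  end.

(* Main.v *)
Require Import Defs.
From HB Require Import structures.
From mathcomp Require Import all_boot all_order all_algebra.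
From mathcomp Require Import boolp classical_sets.
From mathcomp Require Import ring.

(** Write [N_n] for the polynomial [sum_(i <= n) (1 - X)^i], so that
    [B = d N_n(xi)] in degree [n]. Applying [d] and [b] to the cyclicity
    relation [b d N_n + d N_(n-1) b = 0] gives [d xi N_n = 0] and
    [xi N_(n-1) b = 0], and therefore [xi^2 N_n N_(n-1) = 0] in degree [n > 0]
    (while [xi = 0] in degree [0]). The constant term of [N_n] is [n + 1], so
    in each degree the complex is the sum of a part [P] where [xi^2 = 0] and
    a part [Q] where [xi] is invertible; the projector [core] onto [P] is a
    polynomial in [xi] ([xi_fitting]). On [P] one finds
    [b xi = d xi = 0], [B = (n + 1) d] and [b d = - n xi]
    ([mb_md_square_zero]); on [Q] one has [B = 0], and [b] is exact with
    contracting homotopy [d xi^-1] ([mb_cycle_off_core]).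

    Since [xi] is zero for [(b, B)], the homology of [(b, B)] is that of the
    plain sums [T_n] of the [Omega_(n - 2i)] with differential [D = b + B].
    The homology of [(b, d)] is also a quotient of this complex, up to
    a noncanonical choice. Modulo the image of [xi], [b] and [d] square to
    zero and compose to zero in both orders, and [B] is [(n + 1) d]. Choose in
    each degree a complement of [ker b /\ ker d], which contains the images of
    [b] and [d]: as the complement is only a source and the intersection only
    a target, the factor [n + 1] is absorbed by rescaling the two by different
    scalars. This gives a surjective chain map from [(T, D)] to the mixed
    complex of [(b, d)], whose kernel is the image of [xi]
    ([exists_hat_lift]).

    A class for [(b, d)] is thus represented by some [x] with [D x] in the
    image of [xi], and [x |-> core (D x)] induces a map from [H_(n+1)(b, d)] to
    the sum of the [ker xi /\ im xi]. It is surjective because an element [z]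
    of [ker xi /\ im xi] is of the form [b d v] and [B d = 0], so that
    [z = D (d v)]. Its kernel is the image of [H_(n+1)(b, B)], which maps
    injectively, since the cycles of [b] in the image of [xi] are all of the
    form [b d v = D (d v)]. The resulting short exact sequence of vector
    spaces splits. *)

Set Implicit Arguments.
Unset Strict Implicit.
Unset Printing Implicit Defensive.

Import GRing.Theory Num.Theory.
Local Open Scope ring_scope.
Local Open Scope quotient_scope.

(** * Linear relations, complements and split exact sequences *)

(** Maps between quotients are most easily described by relating
    representatives; this turns such a description into an actual linear map. *)
Lemma linear_of_relation (R : pzRingType) (V W : lmodType R)
    (P : V -> W -> Prop) :
    (forall a v w v' w', P v w -> P v' w' -> P (a *: v + v') (a *: w + w')) ->
    (forall v, exists w, P v w) -> (forall w, P 0 w -> w = 0) ->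
  exists f : {linear V -> W}, forall v w, P v w <-> w = f v.
Proof.
move=> Plin Ptot P0.
have Puniq v w w' : P v w -> P v w' -> w = w'.
  move=> Pw /(Plin (-1) _ _ _ _)/(_ Pw).
  by rewrite !scaleN1r addNr => /P0/eqP; rewrite addrC subr_eq0 => /eqP.
pose f v := projT1 (cid (Ptot v)).
have Pf v : P v (f v) := projT2 (cid (Ptot v)).
have flin : linear f by move=> a v v'; apply: (Puniq (a *: v + v')); auto.
pose lf : {linear V -> W} := HB.pack f (GRing.isLinear.Build R V W _ f flin).
by exists lf => v w; split=> [/Puniq|->]; [apply | ].
Qed.

Lemma inj_surj_bijective (A B : Type) (f : A -> B) :
  injective f -> (forall b, exists a, f a = b) -> bijective f.
Proof.
move=> finj /choice[g gK]; exists g => [a|b]; last exact: gK.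
by apply: finj; rewrite gK.
Qed.

(** A maximal subspace meeting [S] trivially is a complement of [S]: a vector
    outside the sum of the two could be added to it. *)
Lemma exists_projector (K : fieldType) (V : lmodType K) (S : V -> Prop) :
    S 0 -> (forall a x y, S x -> S y -> S (a *: x + y)) ->
  exists p : {linear V -> V}, (forall x, S (p x)) /\ (forall x, S x -> p x = x).
Proof.
move=> S0 Slin.
pose lin (C : set V) := forall a x y, C x -> C y -> C (a *: x + y).
pose indep (C : set V) := lin C /\ forall x, C x -> S x -> x = 0.
have [F Find Ftot|C [[Clin CS] Cmax]] := @Zorn_bigcup V indep.
  split=> [a x y [X FX Xx] [Y FY Yy]|x [X FX Xx]]; last exact: (Find X FX).2.
  have [XY|YX] := Ftot X Y FX FY.
    by exists Y => //; apply: (Find Y FY).1 => //; exact: XY.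
  by exists X => //; apply: (Find X FX).1 => //; exact: YX.
(* The empty set satisfies indep, so C is not known to contain 0. *)
pose C0 x := C x \/ x = 0.
have C0lin a x y : C0 x -> C0 y -> C0 (a *: x + y).
  case=> [Cx|->]; case=> [Cy|->]; rewrite ?scaler0 ?addr0 ?add0r.
  - by left; apply: Clin.
  - by left; rewrite -[a](subrK 1) scalerDl scale1r; apply: Clin.
  - by left.
  - by right.
have C0S x : C0 x -> S x -> x = 0 by case=> [/CS|//]; apply.
have CN x : C0 x -> C0 (- x).
  by move=> Cx; rewrite -scaleN1r -[_ *: _]addr0; apply: C0lin => //; right.
have dec v : exists s, S s /\ C0 (v - s).
  apply: contrapT => nv; pose B : set V := fun x => exists a c, C0 c /\ x = a *: v + c.
  apply: (Cmax B).
    split=> [x Cx|BC]; first by exists 0, x; rewrite scale0r add0r; split; [left|].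
    apply: nv; exists 0; split=> //; rewrite subr0; left; apply: BC.
    by exists 1, 0; rewrite scale1r addr0; split; [right|].
  split=> [e _ _ [a [c [Cc ->]]] [a' [c' [Cc' ->]]]|_ [a [c [Cc ->]]] Sx].
    exists (e * a + a'), (e *: c + c'); split; first exact: C0lin.
    by rewrite scalerDr scalerA scalerDl addrACA.
  have [a0|a0] := eqVneq a 0.
    by move: Sx; rewrite a0 scale0r add0r; exact: C0S.
  case: nv; exists (a^-1 *: (a *: v + c)); split.
    by rewrite -[_ *: _]addr0; apply: Slin.
  rewrite scalerDr scalerA mulVf // scale1r opprD addNKr.
  by apply: CN; rewrite -[_ *: _]addr0; apply: C0lin => //; right.
have [||w [Sw]|p pP] := @linear_of_relation K V V (fun v s => S s /\ C0 (v - s)).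
- move=> a v w v' w' [Sw Cw] [Sw' Cw']; split; first exact: Slin.
  by rewrite opprD addrACA -scalerBr; apply: C0lin.
- exact: dec.
- by rewrite sub0r => /CN; rewrite opprK => Cw; exact: C0S.
exists p; split=> [x|x Sx]; first by have [] := (pP x (p x)).2 erefl.
by apply/esym/pP; rewrite subrr; split=> //; right.
Qed.

(** A projector onto the kernel of [p] splits the exact sequence. *)
Lemma split_exact (K : fieldType) (V U W : lmodType K)
    (i : {linear V -> U}) (p : {linear U -> W}) :
    injective i -> (forall w, exists u, p u = w) ->
    (forall u, p u = 0 <-> exists v, i v = u) ->
  lmod_iso U (V * W)%type.
Proof.
move=> iinj psurj exact_ip.
have [||r [rS rK]] := @exists_projector K U (fun u => p u = 0).
- exact: linear0.
- by move=> a x y px py; rewrite linearP px py scaler0 addr0.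
have [|u|[v w]|f fP] :=
  @linear_of_relation K U (V * W)%type (fun u vw => i vw.1 = r u /\ p u = vw.2).
- by move=> a u [v w] u' [v' w'] /= [ev ew] [ev' ew']; rewrite !linearP ev ev' ew ew'.
- by have [v iv] := (exact_ip (r u)).1 (rS u); exists (v, p u).
- rewrite !linear0 /= => -[iv <-]; congr pair.
  by apply: iinj; rewrite iv linear0.
have fE u : i (f u).1 = r u /\ p u = (f u).2 by apply/fP.
exists f; apply: inj_surj_bijective => [|[v w]].
  apply: raddf_inj => u fu0; have [] := fE u.
  by rewrite fu0 /= linear0 => ru /rK <-.
have [u pu] := psurj w; exists (u - r u + i v).
have pi : p (i v) = 0 by apply/exact_ip; exists v.
apply/esym/fP => /=; split; last by rewrite linearD linearB rS subr0 pi addr0.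
by rewrite linearD linearB [r (r u)]rK ?rS // subrr add0r rK.
Qed.

(** * Polynomials in an endomorphism *)

Section PolynomialAction.
Variables (K : comNzRingType) (V : lmodType K) (f : {linear V -> V}).

Definition poly_act (p : {poly K}) (x : V) : V :=
  \sum_(i < size p) p`_i *: iter i f x.

Lemma poly_act_widen n (p : {poly K}) x :
  (size p <= n)%N -> poly_act p x = \sum_(i < n) p`_i *: iter i f x.
Proof.
move=> pn; rewrite /poly_act (big_ord_widen _ (fun i => p`_i *: iter i f x) pn).
rewrite [LHS]big_mkcond; apply: eq_bigr => i _; case: ltnP => // ?.
by rewrite nth_default // scale0r.
Qed.

Fact poly_act_linear p : linear (poly_act p).
Proof.
move=> a x y; rewrite /poly_act scaler_sumr -big_split /=; apply: eq_bigr => i _.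
have -> : iter i f (a *: x + y) = a *: iter i f x + iter i f y.
  by elim: (i : nat) => //= k ->; rewrite linearP.
by rewrite scalerDr !scalerA mulrC.
Qed.
HB.instance Definition _ p :=
  GRing.isLinear.Build K V V _ (poly_act p) (poly_act_linear p).

Lemma poly_actD p q x : poly_act (p + q) x = poly_act p x + poly_act q x.
Proof.
rewrite !(@poly_act_widen (maxn (size p) (size q))) ?leq_maxl ?leq_maxr ?size_polyD //.
by rewrite -big_split; apply: eq_bigr => i _; rewrite coefD scalerDl.
Qed.

Lemma poly_actC c x : poly_act c%:P x = c *: x.
Proof. by rewrite (@poly_act_widen 1) ?size_polyC ?leq_b1 // big_ord1 coefC. Qed.

Lemma poly_actMX p x : poly_act (p * 'X) x = f (poly_act p x).
Proof.
rewrite (@poly_act_widen (size p).+1); last first.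
  by rewrite (leq_trans (size_polyMleq _ _)) // size_polyX addn2.
rewrite big_ord_recl coefMX scale0r add0r raddf_sum; apply: eq_bigr => i _.
by rewrite coefMX /= linearZ.
Qed.

Lemma poly_actX x : poly_act 'X x = f x.
Proof. by have := poly_actMX 1%:P x; rewrite mul1r poly_actC scale1r. Qed.

Lemma poly_actM p q x : poly_act (p * q) x = poly_act p (poly_act q x).
Proof.
elim/poly_ind: p => [|p c IH].
  by rewrite mul0r -polyC0 !poly_actC !scale0r.
rewrite mulrDl !poly_actD mulrAC !poly_actMX IH poly_actC; congr (_ + _).
elim/poly_ind: q {IH} => [|q d IH]; first by rewrite mulr0 -polyC0 !poly_actC !scale0r scaler0.
rewrite mulrDr mulrA -polyCM !poly_actD !poly_actMX IH !poly_actC.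
by rewrite linearZ_LR scalerDr scalerA.
Qed.

Lemma poly_actB p q x : poly_act (p - q) x = poly_act p x - poly_act q x.
Proof. by rewrite poly_actD -mulN1r -polyCN poly_actM poly_actC scaleN1r. Qed.

Lemma poly_actXn n x : poly_act 'X^n x = iter n f x.
Proof.
elim: n => [|n IH]; last by rewrite exprSr poly_actMX IH.
by rewrite expr0 (poly_actC 1) scale1r.
Qed.

End PolynomialAction.

Lemma poly_act_morph (K : comNzRingType) (V W : lmodType K) (f : {linear V -> V})
    (g : {linear W -> W}) (h : {linear V -> W}) :
    (forall x, h (f x) = g (h x)) ->
  forall p x, h (poly_act f p x) = poly_act g p (h x).
Proof.
move=> hfg p x; rewrite /poly_act raddf_sum; apply: eq_bigr => i _.
apply: etrans (linearZ_LR h _ _) _; congr (_ *: _).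
by elim: (i : nat) => //= k <-; rewrite hfg.
Qed.

(** * The operators of a cyclic complex *)

Lemma xiO (M : mixed_complex) x : xi M 0 x = mb M 0 (md M 0 x).
Proof. by []. Qed.

Lemma xiS (M : mixed_complex) n x :
  xi M n.+1 x = mb M n.+1 (md M n.+1 x) + md M n (mb M n x).
Proof. by []. Qed.

(* Simplification would otherwise expand [xi] in positive degrees. *)
Local Opaque xi.

Section CyclicComplex.
Variable M : mixed_complex.
Hypothesis cyclicM : cyclic_complex M.

Local Notation act n := (poly_act (xi M n)).
Local Notation b n := (mb M n).
Local Notation d n := (md M n).

Lemma act_mb n p x : b n (act n.+1 p x) = act n p (b n x).
Proof. by apply: poly_act_morph => y; rewrite xi_mb. Qed.

Lemma act_md n p x : d n (act n p x) = act n.+1 p (d n x).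
Proof. by apply: poly_act_morph => y; rewrite xi_md. Qed.

Lemma act_comm n p q x : act n p (act n q x) = act n q (act n p x).
Proof. by rewrite -!poly_actM mulrC. Qed.

Lemma act_Xn n k p x : act n ('X^(k.+1) * p) x = xi M n (act n ('X^k * p) x).
Proof. by rewrite -poly_actMX exprSr mulrAC. Qed.

Lemma xi_act n p x : xi M n (act n p x) = act n p (xi M n x).
Proof. by rewrite -[LHS](poly_actX (xi M n)) act_comm poly_actX. Qed.

Definition connes_poly n : {poly rat} := \sum_(i < n.+1) (1 - 'X) ^+ i.

Lemma connesE n x : connes x = d n (act n (connes_poly n) x).
Proof.
rewrite /connes /connes_sum /connes_poly; congr (d n _).
elim/big_ind2: _ => [|y p z q -> ->|i _].
- by rewrite -polyC0 poly_actC scale0r.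
- by rewrite poly_actD.
- elim: (i : nat) => [|k IH]; first by rewrite expr0 (poly_actC _ 1) scale1r.
  by rewrite exprS poly_actM -IH poly_actB poly_actX (poly_actC _ 1) scale1r.
Qed.

Lemma connes_poly_split n :
  exists k, connes_poly n = (n.+1%:R)%:P + k * 'X.
Proof.
suff H i : exists k, (1 - 'X) ^+ i = 1 + k * 'X :> {poly rat}.
  rewrite /connes_poly; elim: n.+1 => [|m [k IH]].
    by exists 0; rewrite big_ord0 polyC0 mul0r addr0.
  have [k' e] := H m; exists (k + k'); rewrite big_ord_recr /= IH e.
  by rewrite -[m.+1]addn1 natrD polyCD; ring.
elim: i => [|i [k IH]]; first by exists 0; rewrite expr0 mul0r addr0.
by exists (k - 1 - k * 'X); rewrite exprS IH; ring.
Qed.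

Lemma cyclicS n x :
  b n.+1 (d n.+1 (act n.+1 (connes_poly n.+1) x)) +
  d n (act n (connes_poly n) (b n x)) = 0.
Proof. by have := cyclicM x; rewrite xiS /= !connesE. Qed.

Lemma connes_poly_act n : exists k : {poly rat}, forall x,
  act n (connes_poly n) x = n.+1%:R *: x + act n k (xi M n x).
Proof.
have [k ek] := connes_poly_split n; exists k => x.
by rewrite ek poly_actD poly_actC poly_actM poly_actX.
Qed.

Lemma xi0 x : xi M 0 x = 0.
Proof.
have := cyclicM x; rewrite xiO /= connesE /connes_poly big_ord1 expr0.
by rewrite (poly_actC _ 1) scale1r xiO.
Qed.

(** [d b d = d xi], so this is [d] applied to the cyclicity relation. *)
Lemma md_connes_poly n x : d n (act n ('X * connes_poly n) x) = 0.
Proof.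
rewrite poly_actM poly_actX; case: n x => [|n] x; first by rewrite xi0 linear0.
rewrite xiS linearD /= mdK addr0.
have /(congr1 (d n.+1)) := cyclicS x.
by rewrite linearD linear0 /= mdK addr0.
Qed.

Lemma mb_connes_poly n x : b n (act n.+1 ('X * connes_poly n) x) = 0.
Proof.
rewrite poly_actM poly_actX xiS linearD /= mbK add0r act_mb.
have /(congr1 (b n)) := cyclicS x.
by rewrite linearD linear0 /= mbK add0r.
Qed.

Lemma connes_xi n x : connes (xi M n x) = 0.
Proof. by rewrite connesE -(poly_actX (xi M n)) -poly_actM mulrC md_connes_poly. Qed.

(** Writing [N_n] as its constant term [n + 1] plus a multiple of [X], and
    [d b] as [xi - b d], isolates [b d] up to terms that contain [xi]. *)
Lemma cyclic_first_order n : exists k l : {poly rat}, forall x,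
  n.+1%:R *: xi M n.+1 x + b n.+1 (d n.+1 x) +
  (b n.+1 (d n.+1 (act n.+1 l (xi M n.+1 x))) +
   d n (act n k (xi M n (b n x)))) = 0.
Proof.
have [k ek] := connes_poly_act n; have [l el] := connes_poly_act n.+1.
exists k, l => x; have := cyclicS x; rewrite el ek.
have -> c y z : b n.+1 (d n.+1 (c *: y + z)) = c *: b n.+1 (d n.+1 y) + b n.+1 (d n.+1 z).
  by rewrite !linearP.
rewrite linearP /= => e; rewrite -[RHS]e [RHS]addrACA; congr (_ + _).
by rewrite xiS scalerDr addrAC -[n.+2%:R]natr1 scalerDl scale1r.
Qed.

(** On [M n.+1] the polynomial [X^2 N_n N_(n+1)] acts as zero, because
    [xi = b d + d b], [d] kills the image of [X N_(n+1)], and [b] that of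
    [X N_n]. As [N_n N_(n+1)] has nonzero constant term, the kernel of [xi^2] is
    a direct summand, split off by a polynomial in [xi]. *)
Lemma xi_fitting n :
  exists s : {poly rat}, forall x, act n ('X^2 * (1 - 'X^2 * s)) x = 0.
Proof.
case: n => [|n].
  by exists 0 => x; rewrite !act_Xn xi0.
have [k ek] := connes_poly_split n; have [l el] := connes_poly_split n.+1.
pose c : rat := n.+1%:R * n.+2%:R.
have c0 : c != 0 by rewrite mulf_neq0 // pnatr_eq0.
pose g := connes_poly n * connes_poly n.+1.
have cc : (c^-1)%:P * c%:P = 1 :> {poly rat} by rewrite -polyCM mulVf.
have [u eg] : exists u, g = c%:P * (1 + u * 'X).
  pose v := (n.+1%:R)%:P * l + (n.+2%:R)%:P * k + k * l * 'X.
  exists ((c^-1)%:P * v); transitivity (c%:P + (c^-1)%:P * c%:P * v * 'X); last by ring.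
  by rewrite cc /g /v /c ek el polyCM; ring.
exists (u ^+ 2) => x.
have -> : 'X^2 * (1 - 'X^2 * u ^+ 2) = (c^-1)%:P * (1 - u * 'X) * (('X * g) * 'X).
  transitivity ((c^-1)%:P * c%:P * ('X^2 * (1 - 'X^2 * u ^+ 2))).
    by rewrite cc mul1r.
  by rewrite eg; ring.
rewrite poly_actM poly_actMX xi_act.
suff -> : act n.+1 ('X * g) (xi M n.+1 x) = 0 by rewrite linear0.
rewrite xiS linearD /= -act_mb -!act_md -act_mb.
have -> : 'X * g = 'X * connes_poly n.+1 * connes_poly n by rewrite /g; ring.
rewrite [X in b _ (d _ X) + _]poly_actM md_connes_poly linear0 add0r.
rewrite [X in d _ (b _ X)]
  (_ : _ = act n.+1 ('X * connes_poly n) (act n.+1 (connes_poly n.+1) x)).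
  by rewrite mb_connes_poly linear0.
by rewrite mulrAC poly_actM.
Qed.

Definition fitting_poly n : {poly rat} := projT1 (cid (xi_fitting n)).

(** The projector onto the part where [xi] squares to zero, along the part
    where [xi] is invertible. *)
Definition core n : {linear M n -> M n} :=
  poly_act (xi M n) (1 - 'X^2 * fitting_poly n).

Lemma core_square_zero n x : act n 'X^2 (core n x) = 0.
Proof. by rewrite -poly_actM /fitting_poly; case: cid => s /= ->. Qed.

Lemma core_dec n x : core n x + act n ('X^2 * fitting_poly n) x = x.
Proof. by rewrite /core /= poly_actB (poly_actC _ 1) scale1r subrK. Qed.

Lemma act2E n x : act n 'X^2 x = xi M n (xi M n x).
Proof. by rewrite poly_actXn. Qed.

Lemma core_xi n x : core n (xi M n x) = xi M n (core n x).
Proof. by rewrite /core /= xi_act. Qed.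

Lemma core_id n x : xi M n x = 0 -> core n x = x.
Proof.
move=> x0; rewrite -[RHS]core_dec mulrC poly_actM act2E x0 !linear0.
by rewrite addr0.
Qed.

Lemma act3_act2 n x : act n 'X^3 x = 0 -> act n 'X^2 x = 0.
Proof.
move=> x0; rewrite -[x]core_dec linearD /= core_square_zero add0r -poly_actM.
have -> : 'X^2 * ('X^2 * fitting_poly n) = 'X * fitting_poly n * 'X^3 by ring.
by rewrite poly_actM x0 linear0.
Qed.

Lemma mb_xi_square_zero n x : act n.+1 'X^2 x = 0 -> b n (xi M n.+1 x) = 0.
Proof.
move=> x0; have [k ek] := connes_poly_split n.
have := mb_connes_poly x; rewrite ek.
have -> : 'X * ((n.+1%:R)%:P + k * 'X) = (n.+1%:R)%:P * 'X + k * 'X^2 by ring.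
rewrite poly_actD (poly_actM _ k) x0 linear0 addr0 poly_actM poly_actC poly_actX linearZ.
by move/eqP; rewrite scaler_eq0 pnatr_eq0 => /eqP.
Qed.

Lemma md_xi_square_zero n x : act n 'X^2 x = 0 -> d n (xi M n x) = 0.
Proof.
move=> x0; have [k ek] := connes_poly_split n.
have := md_connes_poly x; rewrite ek.
have -> : 'X * ((n.+1%:R)%:P + k * 'X) = (n.+1%:R)%:P * 'X + k * 'X^2 by ring.
rewrite poly_actD (poly_actM _ k) x0 linear0 addr0 poly_actM poly_actC poly_actX linearZ.
by move/eqP; rewrite scaler_eq0 pnatr_eq0 => /eqP.
Qed.

(** Where [xi] squares to zero, [b xi] and [d xi] vanish, so that the
    cyclicity relation becomes [(n + 2) b d + (n + 1) d b = 0]. *)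
Lemma mb_md_square_zero n x :
  act n.+1 'X^2 x = 0 -> b n.+1 (d n.+1 x) = - n.+1%:R *: xi M n.+1 x.
Proof.
move=> x0; have [k [l /(_ x)]] := cyclic_first_order n.
rewrite xi_mb mb_xi_square_zero // !linear0 addr0 act_md md_xi_square_zero //.
by rewrite !linear0 addr0 => /eqP; rewrite addrC addr_eq0 scaleNr => /eqP.
Qed.

Lemma mb_md_im n x : b n (d n x) \in lin_image (xi M n).
Proof.
case: n x => [|n] x; first by apply/asboolP; exists x.
have [k [l /(_ x)/eqP]] := cyclic_first_order n.
rewrite -!xi_act -!xi_md -xi_mb -[X in _ + X]linearD /= addrAC.
rewrite -linearZ_LR -[X in X + _]linearD addrC addr_eq0 -linearN => /eqP->.
by apply/asboolP; eexists.
Qed.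

Definition mb_cycle n : M n -> Prop :=
  match n with 0 => fun=> True | m.+1 => fun z => b m z = 0 end.

(** Away from the part where [xi] squares to zero, [xi] is invertible, and it
    equals [b d] on cycles of [b]; hence [b] is exact there. *)
Lemma mb_cycle_off_core n z : z \in lin_image (xi M n) -> mb_cycle z ->
  exists y, b n (d n (xi M n y)) = z - core n z.
Proof.
case/asboolP=> w; case: n z w => [|n] z w.
  by rewrite xi0 => <- _; exists 0; rewrite !linear0 addr0.
move=> ezw /= bz.
have bq : b n (z - core _ z) = 0.
  by rewrite linearB bz -ezw core_xi /= mb_xi_square_zero ?subrr // core_square_zero.
pose y := act n.+1 (fitting_poly n.+1) z.
have xixiy : xi M n.+1 (xi M n.+1 y) = z - core _ z.
  by apply/esym/eqP; rewrite subr_eq -act2E -poly_actM addrC core_dec.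
exists y; rewrite -xixiy [RHS]xiS.
(* This element is killed by xi and also a value of xi^2: as the kernels of
   xi^2 and xi^3 agree, it is zero. *)
suff -> : b n (xi M n.+1 y) = 0 by rewrite linear0 addr0.
have e : b n (xi M n.+1 y) = act n 'X^2 (act n (fitting_poly n.+1) (b n w)).
  by rewrite /y -ezw act2E -xi_act -!xi_mb act_mb.
by rewrite e; apply: act3_act2; rewrite exprSr poly_actMX -e xi_mb xixiy bq.
Qed.

(** Where [xi] squares to zero, [xi] itself is a multiple of [b d]. *)
Lemma core_im_mb_md n z : z \in lin_image (xi M n) ->
  exists y, b n (d n y) = core n z.
Proof.
case/asboolP=> w <-; rewrite core_xi; case: n w {z} => [|n] w.
  by exists 0; rewrite xi0 !linear0.
exists (- (n.+1%:R)^-1 *: core n.+1 w); rewrite !linearZ_LR /=.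
rewrite mb_md_square_zero ?core_square_zero // !scaleNr scalerN opprK scalerA.
by rewrite mulVf ?pnatr_eq0 // scale1r.
Qed.

Lemma im_xi_cycle n z : z \in lin_image (xi M n) -> mb_cycle z ->
  exists v, b n (d n v) = z.
Proof.
move=> zi bz; have [y ey] := mb_cycle_off_core zi bz.
have [y' ey'] := core_im_mb_md zi.
by exists (xi M n y + y'); rewrite !linearD /= ey ey' subrK.
Qed.

(** [xi N_n b = 0] in degree [n + 1], and where [xi] squares to zero [xi N_n] is
    [(n + 1) xi]. *)
Lemma core_mb_xi n x : core n (b n (xi M n.+1 x)) = 0.
Proof.
have [k ek] := connes_poly_split n.
have /(congr1 (core n)) := mb_connes_poly x.
rewrite act_mb linear0 ek.
have -> : 'X * ((n.+1%:R)%:P + k * 'X) = (n.+1%:R)%:P * 'X + k * 'X^2 by ring.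
rewrite /core /= act_comm poly_actD.
have := core_square_zero (b n x); rewrite /core /=; set y := act n (1 - _) _ => y0.
rewrite (poly_actM _ k) y0 linear0 addr0 poly_actM poly_actC poly_actX.
move/eqP; rewrite scaler_eq0 pnatr_eq0 /= => /eqP xiy.
by rewrite -xi_mb -xi_act.
Qed.

Lemma core_kernel_cap_image n x :
  x \in lin_image (xi M n) -> core n x \in kernel_cap_image (xi M n).
Proof.
case/asboolP=> y <-; rewrite core_xi; apply/andP; split.
  by apply/eqP; rewrite -act2E core_square_zero.
by apply/asboolP; exists (core n y).
Qed.

Lemma kernel_cap_image_cycle n x :
  x \in kernel_cap_image (xi M n) -> mb_cycle x.
Proof.
case: n x => [|n] x //= /andP[/eqP xix /asboolP[y xE]].
by rewrite -xE mb_xi_square_zero // act2E xE xix.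
Qed.

End CyclicComplex.

(** * Sums over degrees of one parity and their differentials *)

Section Step2Sum.
Implicit Types F G H : nat -> lmodType rat.

Lemma step2_ind (P : nat -> Prop) :
  P 0%N -> P 1%N -> (forall n, P n -> P n.+2) -> forall n, P n.
Proof.
move=> P0 P1 PS n; elim/ltn_ind: n => -[|[|n]] // IH.
by apply: PS; apply: IH.
Qed.

Fixpoint step2_map F G (f : forall n, {linear F n -> G n}) (n : nat) :
    step2_sum F n -> step2_sum G n :=
  match n return step2_sum F n -> step2_sum G n with
  | 0 => f 0%N
  | 1 => f 1%N
  | m.+2 => fun x => (f m.+2 x.1, step2_map f x.2)
  end.

Fact step2_map_linear F G (f : forall n, {linear F n -> G n}) n :
  linear (@step2_map F G f n).
Proof.
elim/step2_ind: n => [||n IH] a x y /=; [exact: linearP|exact: linearP|].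
by rewrite linearP IH.
Qed.
HB.instance Definition _ F G f n :=
  GRing.isLinear.Build rat (step2_sum F n) (step2_sum G n) _ (@step2_map F G f n)
    (@step2_map_linear F G f n).

Lemma step2_map_comp F G H (f : forall n, {linear F n -> G n})
    (g : forall n, {linear G n -> H n}) (h : forall n, {linear F n -> H n}) n x :
  (forall m y, g m (f m y) = h m y) ->
  @step2_map G H g n (step2_map f x) = step2_map h x.
Proof. by move=> e; elim/step2_ind: n x => [||n IH] x /=; rewrite e ?IH. Qed.

Lemma step2_head_map F G (f : forall n, {linear F n -> G n}) n x :
  step2_head (@step2_map F G f n x) = f n (step2_head x).
Proof. by case: n x => [|[|n]]. Qed.

Fixpoint step2_all F (P : forall n, F n -> Prop) (n : nat) : step2_sum F n -> Prop :=
  match n return step2_sum F n -> Prop with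
  | 0 => P 0%N
  | 1 => P 1%N
  | m.+2 => fun x => P m.+2 x.1 /\ step2_all P x.2
  end.

Lemma step2_all_head F (P : forall n, F n -> Prop) n x :
  @step2_all F P n x -> P n (step2_head x).
Proof. by case: n x => [|[|n]] x // []. Qed.

Lemma step2_all_imp F (P Q : forall n, F n -> Prop) n x :
  (forall m y, P m y -> Q m y) -> @step2_all F P n x -> step2_all Q x.
Proof.
move=> PQ; elim/step2_ind: n x => [||n IH] x /=; [exact: PQ|exact: PQ|].
by case=> /PQ ? /IH.
Qed.

Lemma step2_all_and F (P Q : forall n, F n -> Prop) n x :
  @step2_all F P n x -> step2_all Q x -> step2_all (fun m y => P m y /\ Q m y) x.
Proof.
by elim/step2_ind: n x => [||n IH] x //= [? ?] [? ?]; split=> //; apply: IH.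
Qed.

Lemma step2_all_map F G (f : forall n, {linear F n -> G n})
    (P : forall n, G n -> Prop) n x :
  step2_all P (@step2_map F G f n x) <-> step2_all (fun m y => P m (f m y)) x.
Proof. by elim/step2_ind: n x => [||n IH] x //=; rewrite IH. Qed.

Lemma step2_map_image F G (f : forall n, {linear F n -> G n}) n y :
  step2_all (fun m y => exists x, f m x = y) y <->
  exists x, @step2_map F G f n x = y.
Proof.
elim/step2_ind: n y => [||n IH] y //=; split.
  by case=> [[x1 e1] /IH[x2 e2]]; exists (x1, x2); rewrite /= e1 e2 -surjective_pairing.
by case=> x <-; split; [exists x.1|apply/IH; exists x.2].
Qed.

Lemma step2_map_eq0 F G (f : forall n, {linear F n -> G n}) n x :
  @step2_map F G f n x = 0 <-> step2_all (fun m y => f m y = 0) x.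
Proof.
elim/step2_ind: n x => [||n IH] x //=; rewrite -IH.
by split=> [[-> ->]|[-> ->]].
Qed.

(** The formula for the differential of [totM], before passing to the
    quotients by the images of [xi]. *)
Fixpoint step2_diff F (b : forall n, {linear F n.+1 -> F n})
    (d : forall n, {linear F n -> F n.+1}) (n : nat) :
    step2_sum F n.+1 -> step2_sum F n :=
  match n return step2_sum F n.+1 -> step2_sum F n with
  | 0 => fun x => b 0%N x
  | 1 => fun x => b 1%N x.1 + d 0%N x.2
  | m.+2 => fun x =>
      let y : step2_sum F m.+1 := x.2 in
      (b m.+2 x.1 + d m.+1 (step2_head y), step2_diff b d y)
  end.

Fact step2_diff_linear F b d n : linear (@step2_diff F b d n).
Proof.
elim/step2_ind: n => [||n IH] a x y /=; first exact: linearP.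
  by rewrite !linearP /= scalerDr addrACA.
congr pair; last exact: IH.
by rewrite !linearP /= scalerDr addrACA.
Qed.
HB.instance Definition _ F b d n :=
  GRing.isLinear.Build rat (step2_sum F n.+1) (step2_sum F n) _ (@step2_diff F b d n)
    (@step2_diff_linear F b d n).

(** [d] moves a summand one degree up, so it maps the sum ending in degree [n]
    to the one ending in degree [n.+1]; for odd [n] the latter has an extra
    summand in degree [0]. *)
Fixpoint step2_up F (d : forall n, {linear F n -> F n.+1}) (n : nat) :
    step2_sum F n -> step2_sum F n.+1 :=
  match n return step2_sum F n -> step2_sum F n.+1 with
  | 0 => fun x => d 0%N x
  | 1 => fun x => (d 1%N x, 0)
  | m.+2 => fun x => (d m.+2 x.1, step2_up d x.2)
  end.

Lemma step2_head_up F d n x : step2_head (@step2_up F d n x) = d n (step2_head x).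
Proof. by case: n x => [|[|n]]. Qed.

Lemma step2_up_map F (d : forall n, {linear F n -> F n.+1})
    (f : forall n, {linear F n -> F n}) n x :
  (forall m y, d m (f m y) = f m.+1 (d m y)) ->
  @step2_up F d n (step2_map f x) = step2_map f (step2_up d x).
Proof.
by move=> df; elim/step2_ind: n x => [||n IH] x /=; rewrite ?df ?linear0 ?IH.
Qed.

End Step2Sum.

(** * Homology classes of lifts along a surjective chain map *)

(** A surjective chain map lets classes in the target be handled through
    elements of the source, and the image of such an element may be a cycle
    although the element is not. *)
Section ClassOfLift.
Variables (A C : chain_complex) (f : forall n, {linear A n -> C n}).
Hypothesis f_cdiff : forall n x, f n (cdiff A n x) = cdiff C n (f n.+1 x).
Hypothesis f_surj : forall n y, exists x, f n x = y.

Definition class_of_lift n (x : A n) (h : homology C n) : Prop :=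
  exists z : subspace (@Defs.cycle C n), val z = f n x /\ h = \pi_(homology C n) z.

Lemma class_of_lift_linear n a (x x' : A n) h h' :
  class_of_lift x h -> class_of_lift x' h' ->
  class_of_lift (a *: x + x') (a *: h + h').
Proof.
move=> [z [zx ->]] [z' [zx' ->]]; exists (a *: z + z'); split.
  by rewrite [RHS]linearP -zx -zx' [LHS]linearP.
by rewrite -[a *: _](quot_piZ (@boundary C n) a z) -quot_piD.
Qed.

Lemma class_of_lift_exists n (x : A n) :
  f n x \in @Defs.cycle C n <-> exists h, class_of_lift x h.
Proof.
split=> [fx|[h [z [<- _]]]]; last exact: valP.
by exists (\pi_(homology C n) (Subspace fx)), (Subspace fx).
Qed.

Lemma class_of_lift_surj n (h : homology C n) : exists x, class_of_lift x h.
Proof.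
have [z ->] := quot_surj h; have [x fx] := f_surj (val z).
by exists x, z; rewrite fx.
Qed.

Lemma class_of_lift_eq0 n (x : A n) h : class_of_lift x h ->
  h = 0 <-> exists y, f n x = f n (cdiff A n y).
Proof.
move=> [z [zx ->]]; rewrite -quot_pi0.
split=> [/quot_piE|[y e]]; last first.
  apply/quot_piE; rewrite subr0; apply/asboolP; exists (f n.+1 y).
  by rewrite -f_cdiff -e.
rewrite subr0 => /asboolP[w e]; have [y fy] := f_surj w.
by exists y; rewrite f_cdiff fy e.
Qed.

Lemma map_cycle n (x : A n) : x \in @Defs.cycle A n -> f n x \in @Defs.cycle C n.
Proof.
case: n x => // n x /eqP x0; apply/eqP.
by rewrite -f_cdiff x0 linear0.
Qed.

End ClassOfLift.

(** * Two descriptions of mixed homology by lifts *)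

Definition quot_proj (R : pzRingType) (V : lmodType R) (S : submodClosed V)
  (x : V) : quotient S := \pi_(quotient S) x.

Fact quot_proj_linear R V S : linear (@quot_proj R V S).
Proof.
by move=> a x y; rewrite /quot_proj quot_piD quot_piZ.
Qed.
HB.instance Definition _ R V S :=
  GRing.isLinear.Build R V (quotient S) _ (@quot_proj R V S) (@quot_proj_linear R V S).

Lemma quot_proj_eq0 (R : pzRingType) (V : lmodType R) (S : submodClosed V) (x : V) :
  quot_proj S x = 0 <-> x \in S.
Proof. by rewrite /quot_proj -quot_pi0 quot_piE subr0. Qed.

(** When [xi] vanishes, the sums without quotients form a chain complex, and
    a compatible family of surjections onto the quotients of another mixed
    complex presents its mixed homology. *)
Section LiftComplex.
Variable N : mixed_complex.
Hypothesis xiN : forall n x, xi N n x = 0.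

Fact lift_diffK n (x : step2_sum N n.+2) :
  step2_diff (mb N) (md N) (step2_diff (mb N) (md N) x) = 0.
Proof.
have bd0 y : mb N 0 (md N 0 y) = 0 by rewrite -xiO xiN.
have bd m y : mb N m.+1 (md N m.+1 y) + md N m (mb N m y) = 0 by rewrite -xiS xiN.
elim/ltn_ind: n x => -[|[|[|n]]] IH x /=.
- by rewrite linearD /= mbK bd0 addr0.
- by rewrite !linearD /= mbK add0r bd.
- congr pair; last exact: (IH 0%N isT x.2).
  by rewrite !linearD /= mbK mdK add0r addr0 bd.
- congr pair; last exact: (IH n.+1 _ x.2).
  by rewrite !linearD /= mbK mdK add0r addr0 bd.
Qed.

Definition lift_complex : chain_complex :=
  @ChainComplex (step2_sum N) (fun n => @step2_diff N (mb N) (md N) n) lift_diffK.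

Variables (M : mixed_complex) (f : forall n, {linear N n -> hatM M n}).
Hypothesis f_mb : forall n x, f n (mb N n x) = hat_mb M n (f n.+1 x).
Hypothesis f_md : forall n x, f n.+1 (md N n x) = hat_md M n (f n x).
Hypothesis f_surj : forall n y, exists x, f n x = y.

Definition lift_map n : {linear lift_complex n -> tot_complex M n} :=
  @step2_map N (hatM M) f n.

Lemma lift_map_cdiff n x :
  lift_map n (cdiff lift_complex n x) = cdiff (tot_complex M) n (lift_map n.+1 x).
Proof.
rewrite /=; elim/step2_ind: n x => [||n IH] x /=; first exact: f_mb.
  by rewrite linearD /= f_mb f_md.
by rewrite IH linearD /= f_mb f_md step2_head_map.
Qed.

Lemma lift_map_surj n y : exists x, lift_map n x = y.
Proof.
apply/step2_map_image; elim/step2_ind: n y => [||n IH] y /=; try exact: f_surj.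
by split; [exact: f_surj | exact: IH].
Qed.

End LiftComplex.

(** The rescaling that turns [B] into [d] modulo [xi]. In degree [n] it is
    [weight n] on a complement of [ker b /\ ker d] and [weight n.+1] on
    [ker b /\ ker d] itself. This makes it commute with [b], and since [B] is
    [n.+1] times [d] modulo [xi], it takes [B] to [d] when
    [n.+1 * weight n.+2 = weight n]. *)
Fixpoint weight (n : nat) : rat :=
  match n with 0 | 1 => 1 | m.+2 => weight m / m.+1%:R end.

Lemma weight_neq0 n : weight n != 0.
Proof.
by elim/step2_ind: n => //= n IH; rewrite mulf_neq0 // invr_eq0 pnatr_eq0.
Qed.

Lemma weightSS n : n.+1%:R * weight n.+2 = weight n.
Proof. by rewrite /= mulrC divfK // pnatr_eq0. Qed.

(** [f] is [q] followed by the scaling by [c] on [S] and by [a] on a complement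
    of [S]; a map [g] killing [S] cannot see which complement was chosen. *)
Lemma exists_two_scalings (V W : lmodType rat) (q : {linear V -> W})
    (S : W -> Prop) (a c : rat) :
    (forall y, exists x, q x = y) -> S 0 ->
    (forall e x y, S x -> S y -> S (e *: x + y)) -> a != 0 -> c != 0 ->
  exists f : {linear V -> W},
    [/\ forall x, S (q x) -> f x = c *: q x,
        forall (U : lmodType rat) (g : {linear W -> U}) x,
          (forall y, S y -> g y = 0) -> g (f x) = a *: g (q x),
        forall x, f x = 0 <-> q x = 0
      & forall y, exists x, f x = y].
Proof.
move=> qsurj S0 Slin a0 c0; have [p [pS pK]] := exists_projector S0 Slin.
pose f x := a *: q x + (c - a) *: p (q x).
have flin : linear f.
  move=> e x y; rewrite /f (linearP q) (linearP p) /= !scalerDr !scalerA.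
  by rewrite !(mulrC _ e) addrACA.
pose lf : {linear V -> W} := HB.pack f (GRing.isLinear.Build rat V W _ f flin).
have pf x : p (f x) = c *: p (q x).
  by rewrite /f linearD !linearZ_LR /= (pK (p _)) // -scalerDl addrC subrK.
exists lf; split=> /= [x Sx|U g x gS|x|y].
- by rewrite /f pK // -scalerDl addrC subrK.
- by rewrite /f linearD !linearZ_LR /= (gS (p _)) // scaler0 addr0.
- split=> [fx|qx]; last by rewrite /f qx !linear0 addr0.
  have := pf x; rewrite fx linear0 => /esym/eqP.
  rewrite scaler_eq0 (negPf c0) /= => /eqP pq0; move: fx.
  by rewrite /f pq0 scaler0 addr0 => /eqP; rewrite scaler_eq0 (negPf a0) => /eqP.
- have [x qx] := qsurj (a^-1 *: y + (c^-1 - a^-1) *: p y); exists x.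
  have -> : f x = a *: q x + (c - a) *: p (q x) by [].
  have -> : p (q x) = c^-1 *: p y.
    rewrite qx (linearP p) /= (linearZ_LR p) /= (pK (p y)) //.
    by rewrite -scalerDl addrC subrK.
  rewrite qx scalerDr !scalerA divff // scale1r -addrA -scalerDl.
  have -> : a * (c^-1 - a^-1) + (c - a) / c = 0; last by rewrite scale0r addr0.
  by rewrite mulrBr mulrBl !divff // addrA subrK subrr.
Qed.

(** * The comparison of the two homologies *)

Section Comparison.
Variable M : mixed_complex.
Hypothesis cyclicM : cyclic_complex M.
Local Notation N := (connes_complex M).

Definition hat_proj n : {linear M n -> hatM M n} := @quot_proj rat (M n) _.

Lemma hat_proj_mb n x : hat_mb M n (hat_proj n.+1 x) = hat_proj n (mb M n x).
Proof. exact: hat_mbE. Qed.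

Lemma hat_proj_md n x : hat_md M n (hat_proj n x) = hat_proj n.+1 (md M n x).
Proof. exact: hat_mdE. Qed.

Lemma hat_proj_eq0 n x : hat_proj n x = 0 <-> exists y, xi M n y = x.
Proof. by rewrite quot_proj_eq0; split=> [/asboolP|?]; last apply/asboolP. Qed.

Lemma hat_proj_surj n y : exists x, hat_proj n x = y.
Proof. by have [x ->] := quot_surj y; exists x. Qed.

Local Opaque hat_proj.

Lemma hat_proj_connes n x :
  hat_proj n.+1 (connes x) = n.+1%:R *: hat_md M n (hat_proj n x).
Proof.
have [k ek] := connes_poly_act M n; rewrite connesE ek (linearP (md M n)).
rewrite (linearP (hat_proj n.+1)) /= hat_proj_md.
suff /hat_proj_eq0 -> : exists y, xi M n.+1 y = md M n (poly_act (xi M n) k (xi M n x)).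
  by rewrite addr0.
by exists (md M n (poly_act (xi M n) k x)); rewrite -xi_act xi_md.
Qed.

(** [ker b /\ ker d] in the quotient by the image of [xi]. *)
Definition hat_null n : hatM M n -> Prop :=
  match n with
  | 0 => fun x => hat_md M 0 x = 0
  | m.+1 => fun x => hat_md M m.+1 x = 0 /\ hat_mb M m x = 0
  end.

Lemma hat_null_md n x : hat_null x -> hat_md M n x = 0.
Proof. by case: n x => [|n] x // []. Qed.

Lemma hat_null_mb n x : @hat_null n.+1 x -> hat_mb M n x = 0.
Proof. by case. Qed.

Lemma hat_mb_md n x : hat_mb M n (hat_md M n x) = 0.
Proof.
have [y <-] := hat_proj_surj x; rewrite hat_proj_md hat_proj_mb.
exact/hat_proj_eq0/asboolP/mb_md_im.
Qed.

Lemma hat_md_mb n x : hat_md M n (hat_mb M n x) = 0.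
Proof. by have := hat_mbd x; rewrite hat_mb_md add0r. Qed.

Lemma hat_null_mbr n x : hat_null (hat_mb M n x).
Proof.
case: n x => [|n] x; first exact: hat_md_mb.
by split; [exact: hat_md_mb | exact: hat_mbK].
Qed.

Lemma hat_null_mdr n x : hat_null (hat_md M n x).
Proof. by split; [exact: hat_mdK | exact: hat_mb_md]. Qed.

Lemma hat_null0 n : @hat_null n 0.
Proof. by case: n => [|n]; [exact: linear0 | split; exact: linear0]. Qed.

Lemma hat_null_linear n a x y :
  hat_null x -> hat_null y -> @hat_null n (a *: x + y).
Proof.
have lin0 (U : lmodType rat) (g : {linear hatM M n -> U}) :
  g x = 0 -> g y = 0 -> g (a *: x + y) = 0.
  by move=> gx gy; rewrite linearP gx gy scaler0 addr0.
case: n x y lin0 => [|n] x y lin0; first exact: lin0.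
by move=> [? ?] [? ?]; split; exact: lin0.
Qed.

(** The quotient map followed by the rescaling by weights: a noncanonical
    surjection that carries [b] to [b] and [B] to [d]. *)
Lemma exists_hat_lift : exists f : forall n, {linear N n -> hatM M n},
  [/\ forall n x, f n (mb N n x) = hat_mb M n (f n.+1 x),
      forall n x, f n.+1 (md N n x) = hat_md M n (f n x),
      forall n y, exists x, f n x = y
    & forall n x, f n x = 0 <-> exists y, xi M n y = x].
Proof.
pose sc n := exists_two_scalings (@hat_proj_surj n) (hat_null0 n)
  (@hat_null_linear n) (weight_neq0 n) (weight_neq0 n.+1).
pose f n : {linear N n -> hatM M n} := projT1 (cid (sc n)).
have fP n := projT2 (cid (sc n)); exists f; split=> n x.
- have [gS _ _ _] := fP n; have [_ hP _ _] := fP n.+1.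
  have e : hat_proj n (mb M n x) = hat_mb M n (hat_proj n.+1 x) by rewrite hat_proj_mb.
  rewrite hP; last exact: hat_null_mb.
  by rewrite -e; apply: gS; rewrite e; apply: hat_null_mbr.
- have [_ gP _ _] := fP n; have [hS _ _ _] := fP n.+1.
  have e : hat_proj n.+1 (md N n x) = _ := hat_proj_connes x.
  rewrite gP; last exact: hat_null_md.
  rewrite hS e ?scalerA 1?mulrC ?weightSS //.
  rewrite -[_ *: _]addr0; apply: hat_null_linear; last exact: hat_null0.
  exact: hat_null_mdr.
- by have [] := fP n.
- have [_ _ gP _] := fP n; rewrite gP; exact: hat_proj_eq0.
Qed.

Lemma exists_connes_lift : exists f : forall n, {linear N n -> hatM N n},
  [/\ forall n x, f n (mb N n x) = hat_mb N n (f n.+1 x),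
      forall n x, f n.+1 (md N n x) = hat_md N n (f n x),
      forall n y, exists x, f n x = y
    & forall n x, f n x = 0 -> x = 0].
Proof.
exists (fun n => @quot_proj rat (N n) _); split=> n x.
- exact/esym/hat_mbE.
- exact/esym/hat_mdE.
- by have [y ->] := quot_surj x; exists y.
- by move/quot_proj_eq0/asboolP => [y <-]; rewrite cyclicM.
Qed.

Local Notation A := (@lift_complex N cyclicM).

Let D n : {linear step2_sum M n.+1 -> step2_sum M n} := cdiff A n.
Let up n : step2_sum M n -> step2_sum M n.+1 := @step2_up M (md M) n.

Lemma connes_md n x : connes (md M n x) = 0.
Proof. by rewrite connesE -act_md mdK. Qed.

Definition bd n : {linear M n -> M n} := mb M n \o md M n.

(** [B d = 0], so only [b] contributes to the differential of [up x]. *)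
Lemma cdiff_up n x : D n (up x) = step2_map bd x.
Proof.
rewrite /D /up /=; elim/step2_ind: n x => [||n IH] x //=.
  by rewrite linear0 addr0.
by rewrite IH step2_head_up connes_md addr0.
Qed.

(** [B] vanishes on the image of [xi], so that the differential acts there as
    [b] in each degree separately. *)
Lemma cdiff_xi_eq0 n z : @step2_all M (fun m y => exists x, xi M m x = y) n.+1 z ->
  D n z = 0 -> step2_all (@mb_cycle M) z.
Proof.
rewrite /D; elim/step2_ind: n z => [||n IH] z.
- by [].
- by case=> _ [y ey]; rewrite /= -ey connes_xi // addr0.
case: z => z1 z2 [_ zi] e.
have [y ey] := @step2_all_head M (fun m y => exists x, xi M m x = y) n.+1 z2 zi.
split; last by apply: IH zi _; exact: (congr1 snd e).
have : mb M n.+2 z1 + connes (@step2_head M n.+1 z2) = 0 := congr1 fst e.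
by rewrite -ey connes_xi // addr0.
Qed.

Lemma core_cdiff_xi n x :
  step2_map (core cyclicM) (D n (step2_map (xi M) x)) = 0.
Proof.
rewrite /D /=; elim/step2_ind: n x => [||n IH] x /=.
- exact: core_mb_xi.
- by rewrite connes_xi // addr0 core_mb_xi.
- by rewrite IH step2_head_map connes_xi // addr0 core_mb_xi.
Qed.

Lemma cycle_lift n z : step2_all (fun m y => exists x, xi M m x = y) z ->
  step2_all (@mb_cycle M) z -> exists v, D n (up v) = z.
Proof.
move=> zi zc; suff /step2_map_image[v <-] : step2_all (fun m y => exists x, bd m x = y) z.
  by exists v; rewrite cdiff_up.
apply: step2_all_imp (step2_all_and zi zc) => m y [yi yc].
by have [|v vy] := im_xi_cycle cyclicM _ yc; [exact/asboolP | exists v].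
Qed.

Variable f : forall n, {linear N n -> hatM M n}.
Hypothesis f_mb : forall n x, f n (mb N n x) = hat_mb M n (f n.+1 x).
Hypothesis f_md : forall n x, f n.+1 (md N n x) = hat_md M n (f n x).
Hypothesis f_surj : forall n y, exists x, f n x = y.
Hypothesis f_eq0 : forall n x, f n x = 0 <-> exists y, xi M n y = x.

Variable g : forall n, {linear N n -> hatM N n}.
Hypothesis g_mb : forall n x, g n (mb N n x) = hat_mb N n (g n.+1 x).
Hypothesis g_md : forall n x, g n.+1 (md N n x) = hat_md N n (g n x).
Hypothesis g_surj : forall n y, exists x, g n x = y.
Hypothesis g_eq0 : forall n x, g n x = 0 -> x = 0.

Let F n : {linear A n -> tot_complex M n} := @lift_map N cyclicM M f n.
Let G n : {linear A n -> tot_complex N n} := @lift_map N cyclicM N g n.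

Let F_cdiff n x : F n (cdiff A n x) = cdiff (tot_complex M) n (F n.+1 x) :=
  @lift_map_cdiff N cyclicM M f f_mb f_md n x.
Let G_cdiff n x : G n (cdiff A n x) = cdiff (tot_complex N) n (G n.+1 x) :=
  @lift_map_cdiff N cyclicM N g g_mb g_md n x.
Let F_surj n y : exists x, F n x = y := @lift_map_surj N cyclicM M f f_surj n y.
Let G_surj n y : exists x, G n x = y := @lift_map_surj N cyclicM N g g_surj n y.

Let F_all n x : F n x = 0 <->
  @step2_all M (fun m y => exists x, xi M m x = y) n x.
Proof.
rewrite /F /lift_map /= step2_map_eq0.
by split; apply: step2_all_imp => m y /f_eq0.
Qed.

Let F_eq0 n x : F n x = 0 <-> exists w : A n, step2_map (xi M) w = x.
Proof. by rewrite F_all step2_map_image. Qed.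

Let G_inj n : injective (G n).
Proof.
apply: raddf_inj => x /step2_map_eq0 gx.
have: @step2_all M (fun m y => (idfun : {linear M m -> M m}) y = 0) n x.
  by apply: step2_all_imp gx => m y /g_eq0.
move/step2_map_eq0 => <-.
by elim/step2_ind: n x {gx} => [||n IH] x //=; rewrite -IH -surjective_pairing.
Qed.

Local Notation classF := (class_of_lift F).
Local Notation classG := (class_of_lift G).

Let G_cycle n x : G n x \in @Defs.cycle (tot_complex N) n -> x \in @Defs.cycle A n.
Proof.
case: n x => // n x /eqP Gx; apply/eqP; apply: G_inj.
by rewrite G_cdiff Gx linear0.
Qed.

(** Both homologies are described by lifts to the same complex: a cycle there
    has a class in each of them. *)
Lemma homology_map n : exists i : {linear mixed_homology N n -> mixed_homology M n},
  forall h h', h' = i h <-> exists x, classG x h /\ classF x h'.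
Proof.
have [|h|h'|i iP] := @linear_of_relation _ (mixed_homology N n) (mixed_homology M n)
  (fun h h' => exists x, classG x h /\ classF x h').
- move=> a h h' k k' [x [Gx Fx]] [y [Gy Fy]].
  by exists (a *: x + y); split; apply: class_of_lift_linear.
- have [x Gx] := class_of_lift_surj G_surj h.
  have /G_cycle/(map_cycle F_cdiff) : G n x \in @Defs.cycle (tot_complex N) n.
    by apply/class_of_lift_exists; exists h.
  by move/class_of_lift_exists => [h' Fx]; exists h', x.
- move=> [x [Gx Fx]]; apply/(class_of_lift_eq0 F_cdiff F_surj Fx).
  have [y /G_inj ->] := (class_of_lift_eq0 G_cdiff G_surj Gx).1 erefl.
  by exists y.
by exists i => h h'; rewrite iP.
Qed.

Let D_eq n (x : A n.+1) : cdiff A n x = D n x. Proof. by []. Qed.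
Let DK n (x : A n.+2) : D n (D n.+1 x) = 0. Proof. exact: (@cdiffK A). Qed.

(** If the image of a cycle [x] bounds, then [x] differs from a boundary by
    a cycle in the image of [xi], which is itself a boundary by [cycle_lift]. *)
Lemma homology_map_inj n (i : {linear mixed_homology N n -> mixed_homology M n}) :
  (forall h h', h' = i h <-> exists x, classG x h /\ classF x h') -> injective i.
Proof.
move=> iP; apply: raddf_inj => h /esym/iP[x [Gx Fx]].
apply/(class_of_lift_eq0 G_cdiff G_surj Gx).
have [y Fy] := (class_of_lift_eq0 F_cdiff F_surj Fx).1 erefl.
have zi : F n (x - cdiff A n y) = 0 by rewrite linearB Fy subrr.
have /G_cycle xc : G n x \in @Defs.cycle (tot_complex N) n.
  by apply/class_of_lift_exists; exists h.
have [v vE] : exists v, D n (up v) = x - cdiff A n y.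
  move/F_all in zi; apply: cycle_lift => //.
  case: n x y zi xc {i iP h Gx Fx Fy} => [//|n] x y zi xc.
  apply: cdiff_xi_eq0 zi _; move/eqP: xc => xc.
  by rewrite linearB -!D_eq cdiffK subr0.
by exists (up v + y); rewrite linearD D_eq vE subrK.
Qed.

Lemma F_cycle n (x : A n.+1) :
  F n.+1 x \in @Defs.cycle (tot_complex M) n.+1 <-> F n (D n x) = 0.
Proof. by rewrite -D_eq F_cdiff; split=> [/eqP|?]; last apply/eqP. Qed.

Lemma cdiff_mb_cycle n (x : A n.+1) :
  F n (D n x) = 0 -> step2_all (@mb_cycle M) (D n x).
Proof.
case: n x => [//|n] x /F_all Dxi; apply: cdiff_xi_eq0 Dxi _.
by rewrite -!D_eq cdiffK.
Qed.

Local Notation K n := (subspace (kernel_cap_image (xi M n))).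
Let vals n (k : step2_sum (fun m => K m) n) : step2_sum M n :=
  step2_map (fun m => (\val : {linear K m -> M m})) k.

Let vals_inj n (k : step2_sum (fun m => K m) n) : vals k = 0 -> k = 0.
Proof.
rewrite /vals; elim/step2_ind: n k => [||n IH] k /=.
- by move=> e; apply: val_inj; rewrite raddf0; exact: e.
- by move=> e; apply: val_inj; rewrite raddf0; exact: e.
- case: k => k1 k2 /= [e1 e2]; rewrite (IH _ e2); congr pair.
  by apply: val_inj; rewrite raddf0; exact: e1.
Qed.

Let vals_surj n (z : step2_sum M n) :
  step2_all (fun m y => y \in kernel_cap_image (xi M m)) z ->
  exists k, vals k = z.
Proof.
move=> zK; apply/step2_map_image; apply: step2_all_imp zK => m y yK.
by exists (Subspace yK).
Qed.

Let vals_in n (k : step2_sum (fun m => K m) n) :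
  step2_all (fun m y => y \in kernel_cap_image (xi M m)) (vals k).
Proof.
apply/step2_all_map; rewrite /vals; elim/step2_ind: n k => [||n IH] k /=.
- exact: valP.
- exact: valP.
- by split; [exact: valP | exact: IH].
Qed.

Let cores n (x : step2_sum M n) : step2_sum M n := step2_map (core cyclicM) x.

(** The connecting map: a lift [x] of a cycle has differential in the image of
    [xi], and the part of it on which [xi] squares to zero depends only on the
    class of [x]. *)
Lemma connecting_map n :
  exists p : {linear mixed_homology M n.+1 -> kernel_image_sum M n.+1},
  forall h k, k = p h <-> exists x, classF x h /\ vals k = cores (D n x).
Proof.
have [|h|k|p pP] := @linear_of_relation _ (mixed_homology M n.+1)
  (kernel_image_sum M n.+1)
  (fun h k => exists x, classF x h /\ vals k = cores (D n x)).
- move=> a h k h' k' [x [Fx e]] [y [Fy e']]; exists (a *: x + y).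
  split; first exact: class_of_lift_linear.
  by rewrite /vals /cores !linearP /= -/(vals k) -/(vals k') e e'.
- have [x Fx] := class_of_lift_surj F_surj h.
  have /F_cycle/F_all Dxi : F n.+1 x \in @Defs.cycle (tot_complex M) n.+1.
    by apply/class_of_lift_exists; exists h.
  have [|k kE] := @vals_surj n (cores (D n x)); last by exists k, x.
  apply/step2_all_map; apply: step2_all_imp Dxi => m y yi.
  by apply: core_kernel_cap_image; apply/asboolP.
- move=> [x [Fx kE]]; apply: vals_inj; rewrite kE.
  have [y Fy] := (class_of_lift_eq0 F_cdiff F_surj Fx).1 erefl.
  have /F_eq0[w wE] : F n.+1 (x - cdiff A n.+1 y) = 0 by rewrite linearB Fy subrr.
  have -> : D n x = D n (step2_map (xi M) w).
    by rewrite wE linearB D_eq [X in _ - X]DK subr0.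
  exact: core_cdiff_xi.
by exists p => h k; rewrite pP.
Qed.

(** Elements of [ker xi /\ im xi] are cycles of [b] in the image of [xi], and
    thus differentials by [cycle_lift]. *)
Lemma connecting_map_surj n (p : {linear mixed_homology M n.+1 -> kernel_image_sum M n.+1}) :
  (forall h k, k = p h <-> exists x, classF x h /\ vals k = cores (D n x)) ->
  forall k, exists h, p h = k.
Proof.
move=> pP k; have kK := vals_in k.
have ki : @step2_all M (fun m y => exists x, xi M m x = y) n (vals k).
  by apply: step2_all_imp kK => m y /andP[_ /asboolP].
have [|v vE] := cycle_lift ki.
  by apply: step2_all_imp kK => m y; exact: kernel_cap_image_cycle.
have /F_cycle/class_of_lift_exists[h Fv] : F n (D n (up v)) = 0.
  by rewrite vE; apply/F_all.
exists h; apply/esym/pP; exists (up v); split=> //; rewrite vE /cores.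
have {}kK : step2_all (fun m y => core cyclicM m y = y) (vals k).
  by apply: step2_all_imp kK => m y /andP[/eqP yk _]; exact: core_id.
move: (vals k) kK; elim/step2_ind: {k ki v vE h Fv} (n) => [||m IH] z //=.
by case: z => z1 z2 /= [-> /IH <-].
Qed.

(** If [core (D x) = 0] then [D x = b d (xi y)], and subtracting [d (xi y)],
    which lies in the image of [xi], turns [x] into a cycle without changing its
    class. *)
Lemma connecting_map_exact n
    (i : {linear mixed_homology N n.+1 -> mixed_homology M n.+1})
    (p : {linear mixed_homology M n.+1 -> kernel_image_sum M n.+1}) :
  (forall h h', h' = i h <-> exists x, classG x h /\ classF x h') ->
  (forall h k, k = p h <-> exists x, classF x h /\ vals k = cores (D n x)) ->
  forall h, p h = 0 <-> exists h', i h' = h.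
Proof.
move=> iP pP h; split=> [/esym/pP[x [Fx xE]]|[h' /esym/iP[x [Gx Fx]]]]; last first.
  apply/esym/pP; exists x; split=> //.
  have /G_cycle/eqP : G n.+1 x \in @Defs.cycle (tot_complex N) n.+1.
    by apply/class_of_lift_exists; exists h'.
  by rewrite D_eq => ->; rewrite /vals /cores !linear0.
have /F_cycle FDx : F n.+1 x \in @Defs.cycle (tot_complex M) n.+1.
  by apply/class_of_lift_exists; exists h.
have core0 : step2_all (fun m y => core cyclicM m y = 0) (D n x).
  by apply/step2_map_eq0; rewrite -/(cores _) -xE /vals linear0.
pose bdxi m : {linear M m -> M m} := bd m \o xi M m.
have [y yE] : exists y, step2_map bdxi y = D n x.
  apply/step2_map_image.
  apply: step2_all_imp (step2_all_and (step2_all_and (proj1 (F_all _) FDx)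
    (cdiff_mb_cycle FDx)) core0) => m z [[zi zc] z0].
  have [|y yE] := mb_cycle_off_core cyclicM _ zc; first exact/asboolP.
  by exists y; rewrite /= yE z0 subr0.
pose x' : A n.+1 := x - step2_map (xi M) (up y).
have Dx' : D n x' = 0.
  rewrite linearB -yE /up -step2_up_map => [|m z]; last by rewrite xi_md.
  by rewrite -/(up _) cdiff_up (step2_map_comp (h := bdxi)) ?subrr.
have Fx' : classF x' h.
  have [z [zE hE]] := Fx; exists z; split=> //.
  have /F_eq0 Fxi : exists w, step2_map (xi M) w = step2_map (xi M) (up y).
    by exists (up y).
  by rewrite zE linearB Fxi subr0.
have /(map_cycle G_cdiff)/class_of_lift_exists[h' Gx'] : x' \in @Defs.cycle A n.+1.
  exact/eqP.
by exists h'; apply/esym/iP; exists x'.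
Qed.

Lemma mixed_homology_split n :
  lmod_iso (mixed_homology M n) (mixed_homology N n * kernel_image_sum M n)%type.
Proof.
have [i iP] := homology_map n; have iinj := homology_map_inj iP.
case: n i iP iinj => [|n] i iP iinj; last first.
  have [p pP] := connecting_map n.
  apply: (split_exact iinj (connecting_map_surj pP)).
  exact: connecting_map_exact iP pP.
pose p : {linear mixed_homology M 0 -> kernel_image_sum M 0} :=
  \0%R : {linear mixed_homology M 0 -> 'rV[rat]_0}.
apply: (@split_exact _ _ _ _ i p) => // [w|h].
  by exists 0; rewrite linear0; exact/esym/thinmx0.
split=> // _; have [x Fx] := class_of_lift_surj F_surj h.
have /class_of_lift_exists[h' Gx] : G 0 x \in @Defs.cycle (tot_complex N) 0 by [].
by exists h'; apply/esym/iP; exists x.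
Qed.

End Comparison.

Theorem corollary1 (M : mixed_complex) (cyclicM : cyclic_complex M) (n : nat) :
  lmod_iso (mixed_homology M n)
    (mixed_homology (connes_complex M) n * kernel_image_sum M n)%type.
Proof.
have [f [f_mb f_md f_surj f_eq0]] := exists_hat_lift cyclicM.
have [g [g_mb g_md g_surj g_eq0]] := exists_connes_lift cyclicM.
exact: (mixed_homology_split cyclicM f_mb f_md f_surj f_eq0 g_mb g_md g_surj g_eq0).
Qed.
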